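(* Let $\Xi\subset\mathbb{R}^{N}$ be a compact convex set with non-empty interior, and let $\operatorname{ext}(\Xi)$ be its set of extreme points. The fully adjustable robust counterpart is the special case of the multipolar robust counterpart with shadow matrix $P=I$ and $\Omega=\operatorname{ext}(\Xi)$: the MRC problem for $\Xi$, $P=I$, $\Omega=\operatorname{ext}(\Xi)$ has the same optimal value as the FARC problem for $\Xi$.
   Context: Setting: $m,n,q\ge 1$ are integers, $V\in\mathbb{R}^{m\times q}$ and $c\in\mathbb{R}^n$ are fixed. An uncertain parameter is $\xi\equiv[U_\xi,b_\xi]$ with $U_\xi\in\mathbb{R}^{m\times n}$, $b_\xi\in\mathbb{R}^m$, identified with a vector of $\mathbb{R}^N$, $N=m(n+1)$. Vector inequalities are componentwise; optimal values are infima in $[-\infty,+\infty]$. FARC: minimize $c^Tu$ over $u\in\mathbb{R}^n$ and arbitrary functions $v:\Xi\to\mathbb{R}^q$ subject to $U_\xi u+Vv(\xi)\le b_\xi$ for all $\xi\in\Xi$. MRC with $P=I$ and a set of poles $\Omega\subset\mathbb{R}^N$ with $\Xi\subseteq\operatorname{conv}\Omega$: for $\xi\in\Xi$, let $\Lambda_\xi$ be the set of finitely supported families $(\lambda_\omega)_{\omega\in\Omega}$ of nonnegative reals with $\sum_\omega\lambda_\omega=1$ and $\sum_\omega\lambda_\omega\omega=\xi$; minimize $c^Tu$ over $u\in\mathbb{R}^n$ and $v_\omega\in\mathbb{R}^q$ ($\omega\in\Omega$) subject to $U_\xi u+V\sum_{\omega}\lambda_\omega v_\omega\le b_\xi$ for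 all $\xi\in\Xi$ and all $\lambda\in\Lambda_\xi$. *)

(* Defs.v *)
From HB Require Import structures.
From mathcomp Require Import all_boot all_order all_algebra.
From mathcomp Require Import all_classical all_reals all_analysis.

Set Implicit Arguments.
Unset Strict Implicit.
Unset Printing Implicit Defensive.

Import Order.TTheory GRing.Theory Num.Theory.
Import numFieldNormedType.Exports.

Local Open Scope classical_set_scope.
Local Open Scope ring_scope.

Section Convexity.
Context {R : realType} {E : lmodType R}.
Implicit Types (A : set E) (x : E).

(* The families of barycentric weights of [x] over [A]; only the values of
   [w] on [A] matter.  The finiteness clause is essential: [\sum_(a \in A)]
   is a junk value when the support is infinite. *)
Definition weights A x : set (E -> R) :=
  [set w | [/\ finite_set (A `&` [set a | w a != 0]),
               (forall a, A a -> 0 <= w a),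
               \sum_(a \in A) w a = 1 &
               \sum_(a \in A) w a *: a = x]].

Definition convex_hull A : set E := [set x | weights A x !=set0].

Definition extreme_points A : set E :=
  [set x | A x /\ forall y z (t : R), A y -> A z -> 0 < t < 1 ->
                  x = t *: y + (1 - t) *: z -> y = x /\ z = x].

End Convexity.

Section RobustCounterparts.
Context {R : realType} {m n q : nat}.

Definition vec_le (x y : 'cV[R]_m) : Prop := forall i, x i 0 <= y i 0.

(* An uncertain parameter [U, b] is the m x (n + 1) block matrix row_mx U b;
   R^N with N = m(n + 1) is the space of these matrices, whose vector space
   structure and topology are the entrywise ones. *)
Local Notation param := 'M[R]_(m, n + 1).

Definition Upart (xi : param) : 'M[R]_(m, n) := lsubmx xi.
Definition bpart (xi : param) : 'cV[R]_m := rsubmx xi.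

Variables (V : 'M[R]_(m, q)) (c : 'cV[R]_n).

Definition cost (u : 'cV[R]_n) : R := (c^T *m u) 0 0.

(* Only the values of the recourse [v] on [Xi] matter, so that total functions
   stand for functions defined on [Xi]. *)
Definition FARC_feasible (Xi : set param) (u : 'cV[R]_n)
    (v : param -> 'cV[R]_q) : Prop :=
  forall xi, Xi xi -> vec_le (Upart xi *m u + V *m v xi) (bpart xi).

Definition FARC_value (Xi : set param) : \bar R :=
  ereal_inf [set (cost u)%:E | u in
    [set u | exists v, FARC_feasible Xi u v]].

(* Shadow matrix P = I.  Only the values of [v] on the set [Om] of poles
   matter.  The problem is only meant for pole sets with
   [Xi `<=` convex_hull Om]: a point [xi] without weights over [Om] would
   impose no constraint. *)
Definition MRC_feasible (Xi Om : set param) (u : 'cV[R]_n)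
    (v : param -> 'cV[R]_q) : Prop :=
  forall xi, Xi xi -> forall w, weights Om xi w ->
    vec_le (Upart xi *m u + V *m (\sum_(om \in Om) w om *: v om)) (bpart xi).

Definition MRC_value (Xi Om : set param) : \bar R :=
  ereal_inf [set (cost u)%:E | u in
    [set u | exists v, MRC_feasible Xi Om u v]].

End RobustCounterparts.

(* Main.v *)
(* Call d an inner direction of the compact convex set K at x when
   x + e d and x - e d lie in K for some e > 0; these d form a subspace D(x),
   which is zero only if x is extreme.  If D(x) contains d <> 0, let y and z be
   the ends of the segment of K through x along d.  Then D(y) and D(z) are
   contained in D(x) but miss d, so induction on the dimension puts y and z,
   hence x, in the convex hull of the extreme points.
   Given this, a feasible MRC solution yields a recourse by choosing weights for
   each xi; conversely, since U u + V v - b is linear in (U, b, v), the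
   constraints of a FARC recourse at the poles imply the MRC constraints. *)
Require Import Defs.
From HB Require Import structures.
From mathcomp Require Import all_boot all_order all_algebra.
From mathcomp Require Import all_classical all_reals all_analysis.
From mathcomp Require Import ring.

Set Implicit Arguments.
Unset Strict Implicit.
Unset Printing Implicit Defensive.

Import Order.TTheory GRing.Theory Num.Theory.
Import numFieldNormedType.Exports.

Local Open Scope classical_set_scope.
Local Open Scope ring_scope.

(** * Barycentric weights, convex hulls and inner directions *)

Section ConvexHull.
Context {R : realType} {E : lmodType R}.
Implicit Types (A F : set E) (x y z : E).

Lemma convex_set_comb A y z (t : R) : convex_set A -> A y -> A z ->
  0 <= t -> t <= 1 -> A (t *: y + (1 - t) *: z).
Proof.
move=> cA /mem_set Ay /mem_set Az t0 t1.
exact: (set_mem (cA y z (Itv01 t0 t1) Ay Az)).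
Qed.

(** Passing to a finite [F] that contains the support gives a genuine finite sum, on which
    additivity and linearity are available. *)
Lemma weighted_sum_widen (V : lmodType R) A F (w : E -> R) (g : E -> V) :
  F `<=` A -> A `&` [set a | w a != 0] `<=` F ->
  \sum_(a \in A) w a *: g a = \sum_(a \in F) w a *: g a.
Proof.
move=> FA AF; apply/esym/fsbig_widen => // a [Aa Fa] /=.
have [->|w0] := eqVneq (w a) 0; first by rewrite scale0r.
by case: Fa; exact: AF.
Qed.

Lemma sum_weights_widen A F (w : E -> R) :
  F `<=` A -> A `&` [set a | w a != 0] `<=` F ->
  \sum_(a \in A) w a = \sum_(a \in F) w a.
Proof.
move=> FA AF; apply/esym/fsbig_widen => // a [Aa Fa] /=.
have [//|w0] := eqVneq (w a) 0; by case: Fa; exact: AF.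
Qed.

Lemma sub_convex_hull A : A `<=` convex_hull A.
Proof.
move=> x Ax; pose w a : R := (a == x)%:R.
have xA : [set x] `<=` A by move=> _ ->.
have wx : A `&` [set a | w a != 0] `<=` [set x].
  by move=> a [_] /=; rewrite /w; have [->|_] := eqVneq a x; rewrite ?mulr0n ?eqxx.
exists w; split.
- exact: sub_finite_set wx (finite_set1 x).
- by move=> a _; rewrite ler0n.
- by rewrite (sum_weights_widen xA wx) fsbig_set1 /w eqxx.
- by rewrite (weighted_sum_widen _ xA wx) fsbig_set1 /w eqxx scale1r.
Qed.

Lemma convex_hull_comb A y z (t : R) : convex_hull A y -> convex_hull A z ->
  0 <= t -> t <= 1 -> convex_hull A (t *: y + (1 - t) *: z).
Proof.
move=> [v [fv v0 v1 vy]] [w [fw w0 w1 wz]] t0 t1.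
(* On the union of the two supports, both families and their mixture are summed over one finite
   set. *)
pose F := (A `&` [set a | v a != 0]) `|` (A `&` [set a | w a != 0]).
have FA : F `<=` A by move=> a [] [].
have fF : finite_set F by rewrite finite_setU.
have vF : A `&` [set a | v a != 0] `<=` F by move=> a; left.
have wF : A `&` [set a | w a != 0] `<=` F by move=> a; right.
pose s a := t * v a + (1 - t) * w a.
have sF : A `&` [set a | s a != 0] `<=` F.
  move=> a [Aa /= sa]; have [va|va] := eqVneq (v a) 0; last by left.
  right; split=> //=; apply: contra_neq sa => wa.
  by rewrite /s va wa !mulr0 addr0.
exists s; split.
- exact: sub_finite_set sF fF.
- by move=> a Aa; rewrite addr_ge0 // mulr_ge0 ?subr_ge0 //; [exact: v0|exact: w0].
- rewrite (sum_weights_widen FA sF) fsbig_split //= -!mulr_fsumr.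
  rewrite -(sum_weights_widen FA vF) -(sum_weights_widen FA wF) v1 w1.
  by rewrite !mulr1 addrC subrK.
- rewrite (weighted_sum_widen _ FA sF) -vy -wz.
  rewrite (weighted_sum_widen _ FA vF) (weighted_sum_widen _ FA wF).
  rewrite !fsbig_finite //= !scaler_sumr -big_split /=.
  by apply: eq_bigr => a _; rewrite !scalerA -scalerDl.
Qed.

(** For convex [A] and [x] in [A], this is the direction space of the smallest face of [A]
    containing [x]. *)
Definition inner_direction A x : set E :=
  [set d | exists2 e : R, 0 < e & A (x + e *: d) /\ A (x - e *: d)].

Lemma convex_set_shift A x (u v : E) (s : R) : convex_set A ->
  A (x + u) -> A (x + v) -> 0 <= s -> s <= 1 ->
  A (x + (s *: u + (1 - s) *: v)).
Proof.
move=> cA Au Av s0 s1; have := convex_set_comb cA Au Av s0 s1.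
by rewrite !scalerDr addrACA -scalerDl [s + _]addrC subrK scale1r.
Qed.

Lemma inner_direction0 A x : A x -> inner_direction A x 0.
Proof. by move=> Ax; exists 1; rewrite ?scaler0 ?subr0 ?addr0. Qed.

Lemma inner_directionN A x d : inner_direction A x d -> inner_direction A x (- d).
Proof. by move=> [e e0 [A1 A2]]; exists e; rewrite // scalerN opprK. Qed.

Lemma inner_directionZ A x (a : R) d : A x ->
  inner_direction A x d -> inner_direction A x (a *: d).
Proof.
move=> Ax Dd; have [->|a0] := eqVneq a 0.
  by rewrite scale0r; exact: inner_direction0.
suff pos (b : R) : 0 < b -> inner_direction A x (b *: d).
  have [|a_le0] := ltP 0 a; first exact: pos.
  rewrite -[a]opprK scaleNr; apply/inner_directionN/pos.
  by rewrite oppr_gt0 lt_neqAle a0.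
move=> b0; have [e e0 Ae] := Dd; exists (e / b); first exact: divr_gt0.
by rewrite scalerA divfK // gt_eqF.
Qed.

Lemma inner_directionD A x d f : convex_set A ->
  inner_direction A x d -> inner_direction A x f ->
  inner_direction A x (d + f).
Proof.
move=> cA [a a0 [A1 A2]] [b b0 [B1 B2]].
have ab0 : 0 < a + b by exact: addr_gt0.
have ab_neq0 : a + b != 0 by rewrite gt_eqF.
(* This weight balances the steps: [s * a = (1 - s) * b], so the mixture moves equally far along [d]
   and [f]. *)
pose s := b / (a + b).
have s0 : 0 <= s by rewrite divr_ge0 // ltW.
have s1 : s <= 1 by rewrite ler_pdivrMr // mul1r lerDr ltW.
have sa : s * a = a * b / (a + b) by rewrite /s; field.
have sb : (1 - s) * b = a * b / (a + b) by rewrite /s; field.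
clearbody s; exists (a * b / (a + b)); first by rewrite divr_gt0 // mulr_gt0.
rewrite -scalerN opprD !scalerDr -{1 3}sa -!sb -!scalerA.
by split; apply: convex_set_shift; rewrite ?scalerN.
Qed.

Lemma not_extreme_inner_direction A x : convex_set A -> A x ->
  ~ extreme_points A x -> exists2 d, d != 0 & inner_direction A x d.
Proof.
move=> cA Ax nex; apply: contrapT => nD; apply: nex.
have D0 d : inner_direction A x d -> d = 0.
  by move=> Dd; apply: contrapT => /eqP d0; apply: nD; exists d.
split=> // y z t Ay Az /andP[t0 t1] xE.
have yE : y = x + (1 - t) *: (y - z).
  rewrite xE scalerBr addrACA subrr addr0 -scalerDl [t + _]addrC subrK.
  by rewrite scale1r.
have zE : z = x - t *: (y - z).
  rewrite xE scalerBr opprB addrC addrA subrK -scalerDl.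
  by rewrite [t + _]addrC subrK scale1r.
suff yz0 : y - z = 0.
  by move: yE zE; rewrite yz0 !scaler0 subr0 addr0.
(* From [x], the point [y] is [1 - t] away and [z] is [t] away, in units of [y - z]; shrinking by
   [t] and [1 - t] respectively gives the common step [t * (1 - t)]. *)
apply: D0; exists (t * (1 - t)); first by rewrite mulr_gt0 // subr_gt0.
have Ax0 : A (x + 0) by rewrite addr0.
split.
  have -> : (t * (1 - t)) *: (y - z) =
      t *: ((1 - t) *: (y - z)) + (1 - t) *: 0.
    by rewrite scaler0 addr0 scalerA.
  by apply: convex_set_shift; rewrite -?yE // ltW.
have -> : - ((t * (1 - t)) *: (y - z)) =
    (1 - t) *: - (t *: (y - z)) + (1 - (1 - t)) *: 0.
  by rewrite scaler0 addr0 scalerN scalerA mulrC.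
by apply: convex_set_shift; rewrite -?zE // ?subr_ge0 ?gerBl ltW.
Qed.

(** The homothety of centre [x - b *: d] and ratio [b / (a + b)] sends [x + a *: d] to [x] and, by
    convexity, maps [A] into itself; it shrinks the segment along [f] without turning it. *)
Lemma inner_direction_line A x d f (a b : R) : convex_set A ->
  0 < a -> 0 < b -> A (x - b *: d) ->
  inner_direction A (x + a *: d) f -> inner_direction A x f.
Proof.
move=> cA a0 b0 Ab [e e0 [A1 A2]].
have ab0 : 0 < a + b by exact: addr_gt0.
have ab_neq0 : a + b != 0 by rewrite gt_eqF.
pose s := b / (a + b).
have s0 : 0 < s by exact: divr_gt0.
have s1 : s <= 1 by rewrite ler_pdivrMr // mul1r lerDr ltW.
have sE g : s *: (a *: d + g) + (1 - s) *: (- (b *: d)) = s *: g.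
  rewrite scalerDr scalerN !scalerA addrAC -scalerBl.
  by rewrite (_ : _ - _ = 0) ?scale0r ?add0r // /s; field.
clearbody s; exists (s * e); first exact: mulr_gt0.
rewrite -!scalerA -scalerN -(sE (e *: f)) -(sE (- (e *: f))).
by split; apply: convex_set_shift; rewrite // ?addrA // ltW.
Qed.

End ConvexHull.

(** * Finite-dimensional convex sets as hulls of their extreme points *)

Section Minkowski.
Context {R : realType} {E : vectType R}.
Variable K : set E.
Hypothesis K_convex : convex_set K.
(** The only consequence of compactness that the induction needs; applied to [d] and [- d], it
    yields both ends of a segment. *)
Hypothesis K_line : forall x d, K x -> d != 0 ->
  exists2 t : R, K (x + t *: d) & forall s, K (x + s *: d) -> s <= t.

Lemma inner_direction_span x (s : seq E) : K x ->
  {in s, forall d, inner_direction K x d} ->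
  {in span s, forall d, inner_direction K x d}.
Proof.
move=> Kx Ds d; rewrite -[s]/(tval (in_tuple s)) => /coord_span ->.
apply: big_ind => [|u v|i _]; first exact: inner_direction0.
  exact: inner_directionD.
by apply/inner_directionZ/Ds => //; rewrite mem_nth.
Qed.

Lemma far_end x d : K x -> d != 0 -> inner_direction K x d ->
  exists2 t : R, 0 < t & K (x + t *: d) /\
    ~ inner_direction K (x + t *: d) d.
Proof.
move=> Kx d0 [e e0 [Ke _]]; have [t Kt tmax] := K_line Kx d0.
exists t; first exact: lt_le_trans e0 (tmax _ Ke).
split=> // -[f f0 [+ _]]; rewrite -addrA -scalerDl => /tmax.
by rewrite gerDl leNgt f0.
Qed.

(** The inner directions at the end form a subspace that misses [d], so [d] is independent of [s];
    they remain inner at [x], which lies strictly between two points of [K]. *)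
Lemma free_far_end x d (s : seq E) (a b : R) : 0 < a -> 0 < b ->
  K (x - b *: d) -> K (x + a *: d) -> inner_direction K x d ->
  ~ inner_direction K (x + a *: d) d -> free s ->
  {in s, forall f, inner_direction K (x + a *: d) f} ->
  free (d :: s) /\ {in d :: s, forall f, inner_direction K x f}.
Proof.
move=> a0 b0 Kb Ka Dd nDd sfree Ds; split.
  rewrite free_cons sfree andbT; apply/negP.
  by move=> /(inner_direction_span Ka Ds).
move=> f; rewrite inE => /predU1P[->//|/Ds].
exact: inner_direction_line K_convex a0 b0 Kb.
Qed.

(* Both ends of a maximal segment of [K] through [x] have strictly fewer
   independent inner directions than [x]. *)
Lemma convex_hull_extreme_free k x : K x ->
  (forall s : seq E, free s -> {in s, forall d, inner_direction K x d} ->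
     (size s <= k)%N) ->
  convex_hull (extreme_points K) x.
Proof.
elim: k x => [|k IHk] x Kx sz;
  (have [xext|] := pselect (extreme_points K x); first exact: sub_convex_hull);
  move=> /(not_extreme_inner_direction K_convex Kx)[d d0 Dd].
  (* For [k = 0], a single nonzero inner direction is already too long a free family. *)
  suff: (1 <= 0)%N by [].
  apply: (sz [:: d]); first by rewrite seq1_free.
  by move=> f; rewrite inE => /eqP->.
have [a a0 [Ka nDa]] := far_end Kx d0 Dd.
have DNd := inner_directionN Dd.
have Nd0 : - d != 0 by rewrite oppr_eq0.
have [b b0 [Kb nDb]] := far_end Kx Nd0 DNd.
have ya : convex_hull (extreme_points K) (x + a *: d).
  apply: IHk => // s sfree Ds.
  have Kb' : K (x - b *: d) by rewrite -scalerN.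
  have [sfree' Ds'] := free_far_end a0 b0 Kb' Ka Dd nDa sfree Ds.
  (* The bound [k.+1] on [d :: s] is the bound [k] on [s]. *)
  exact: sz sfree' Ds'.
have yb : convex_hull (extreme_points K) (x + b *: - d).
  apply: IHk => // s sfree Ds.
  have Ka' : K (x - a *: - d) by rewrite scalerN opprK.
  have [sfree' Ds'] := free_far_end b0 a0 Ka' Kb DNd nDb sfree Ds.
  exact: sz sfree' Ds'.
have ab0 : 0 < a + b by exact: addr_gt0.
have ab_neq0 : a + b != 0 by rewrite gt_eqF.
(* The weight [b / (a + b)] on [x + a *: d] cancels the displacement and recovers [x]. *)
have s0 : 0 <= b / (a + b) by rewrite divr_ge0 // ltW.
have s1 : b / (a + b) <= 1 by rewrite ler_pdivrMr // mul1r lerDr ltW.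
have := convex_hull_comb ya yb s0 s1.
rewrite !scalerDr addrACA -scalerDl [_ / _ + _]addrC subrK scale1r !scalerN.
rewrite !scalerA -scalerBl (_ : _ - _ = 0) ?scale0r ?addr0 //; by field.
Qed.

Lemma sub_convex_hull_extreme : K `<=` convex_hull (extreme_points K).
Proof.
move=> x Kx; apply: (@convex_hull_extreme_free (\dim {:E})) => // s sfree _.
by move/eqP: sfree => <-; exact/dimvS/subvf.
Qed.

End Minkowski.

(** The parameters of the points of [K] on the line form a nonempty compact set of reals, which has
    a maximum. *)
Lemma compact_line_max {R : realType} {E : normedModType R} (K : set E) x d :
  compact K -> K x -> d != 0 ->
  exists2 t : R, K (x + t *: d) & forall s, K (x + s *: d) -> s <= t.
Proof.
move=> Kc Kx d0.
have d_gt0 : 0 < `|d| by rewrite normr_gt0.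
pose S := [set t : R | K (x + t *: d)].
have [M KM] : exists M : R, forall y, K y -> `|y| <= M.
  have [M [_ KM]] := compact_bounded Kc.
  (* Boundedness only provides bounds strictly above [M], hence [M + 1]. *)
  by exists (M + 1) => y Ky; apply: (KM (M + 1)) => //; rewrite ltrDl.
pose B := (M + `|x|) / `|d|.
have SB t : S t -> `|t| <= B.
  move=> /KM tM; rewrite ler_pdivlMr // -normrZ.
  rewrite -[t *: d](addrK x) [_ + x]addrC.
  by rewrite (le_trans (ler_normB _ _)) // lerD2r.
have Scl : closed S.
  apply: (@preimage_closed _ _ (fun t : R => x + t *: d)).
    move=> t _; apply: cvgD; first exact: cvg_cst.
    by apply: cvgZr_tmp.
  exact: compact_closed Kc.
have Sc : compact S.
  apply: (@subclosed_compact _ _ `[- B, B]%classic) => //.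
    exact: segment_compact.
  by move=> t /SB; rewrite /= in_itv /= ler_norml.
have S0 : S !=set0 by exists 0; rewrite /S /= scale0r addr0.
have [|t /set_mem St tmax] := compact_EVT_max (f := @id R) S0 Sc.
  by apply: continuous_subspaceT => z; exact: cvg_id.
by exists t => // s Ss; apply: tmax; exact: mem_set.
Qed.

(** * Translating feasible solutions between the two problems *)

Section Feasibility.
Context {R : realType} {m n q : nat}.
Variables (V : 'M[R]_(m, q)) (Xi Om : set 'M[R]_(m, n + 1)).

Lemma FARC_feasible_MRC (u : 'cV[R]_n) v : Om `<=` Xi ->
  FARC_feasible V Xi u v -> MRC_feasible V Xi Om u v.
Proof.
move=> OmXi fv xi _ w [fw w0 _ <-] i.
pose F := Om `&` [set om | w om != 0].
have FOm : F `<=` Om by move=> om [].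
rewrite !(@weighted_sum_widen _ _ _ Om F) // !fsbig_finite //.
rewrite /Upart /bpart !linear_sum /= mulmx_suml -big_split /=.
rewrite !summxE big_seq [leRHS]big_seq; apply: ler_sum => om.
rewrite in_fset_set // => /set_mem /FOm Omom.
rewrite !linearZ /= -scalemxAl -scalerDr !mxE.
(* Each pole contributes its own constraint, available because poles lie in [Xi], scaled by a
   nonnegative weight. *)
by apply: ler_wpM2l; rewrite ?w0 //; have := fv om (OmXi _ Omom) i; rewrite !mxE.
Qed.

Lemma MRC_feasible_FARC (u : 'cV[R]_n) v : Xi `<=` convex_hull Om ->
  MRC_feasible V Xi Om u v -> exists v', FARC_feasible V Xi u v'.
Proof.
move=> XiOm fv.
have /choice[w wP] xi : exists w, Xi xi -> weights Om xi w.
  have [/XiOm[w wxi]|nXi] := pselect (Xi xi); first by exists w.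
  (* Choice needs a total function; the value outside [Xi] is arbitrary. *)
  by exists (fun=> 0).
exists (fun xi => \sum_(om \in Om) w xi om *: v om) => xi Xixi.
exact: fv Xixi _ (wP xi Xixi).
Qed.

(** Both problems admit the same first-stage [u], so the infima agree whether or not they are
    attained. *)
Lemma MRC_value_FARC (c : 'cV[R]_n) : Om `<=` Xi -> Xi `<=` convex_hull Om ->
  MRC_value V c Xi Om = FARC_value V c Xi.
Proof.
move=> OmXi XiOm; rewrite /MRC_value /FARC_value; congr (ereal_inf (image _ _)).
apply/seteqP; split=> u [v fv]; first exact: MRC_feasible_FARC fv.
by exists v; exact: FARC_feasible_MRC.
Qed.

End Feasibility.

(** The first conjunct certifies that the extreme points are an admissible pole set, so that no
    point of [Xi] escapes its constraints for lack of weights. *)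
Theorem mainTheorem8 (R : realType) (m n q : nat)
    (m_ge1 : (1 <= m)%N) (n_ge1 : (1 <= n)%N) (q_ge1 : (1 <= q)%N)
    (V : 'M[R]_(m, q)) (c : 'cV[R]_n)
    (Xi : set 'M[R]_(m, n + 1))
    (Xi_compact : compact Xi) (Xi_convex : convex_set Xi)
    (Xi_interior : interior Xi !=set0) :
  Xi `<=` convex_hull (extreme_points Xi) /\
  MRC_value V c Xi (extreme_points Xi) = FARC_value V c Xi.
Proof.
have Xi_hull : Xi `<=` convex_hull (extreme_points Xi).
  apply: sub_convex_hull_extreme => // x d.
  exact: compact_line_max.
by split=> //; apply: MRC_value_FARC => // x [].
Qed.
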